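(* Let $X=\ell_1$ (complex). A typical $T\in(\mathcal{P}_1(X),\mathrm{SOT})$ is such that $T^*$ is a non-surjective isometry and such that $T-\lambda$ is surjective for every $\lambda\in\mathbb{D}$.
   Context: $X=\ell_1=\ell_1(\mathbb{Z}_+)$ is equipped with its canonical basis. A vector is positive if all its coordinates are $\ge0$; a bounded operator $T$ on $X$ is positive if it maps positive vectors to positive vectors. $\mathcal{P}_1(X)$ is the set of bounded positive operators with $\|T\|\le1$. $T^*$ is the adjoint acting on $X^*$. $\mathbb{D}$ is the open unit disk of $\mathbb{C}$; $T-\lambda$ means $T-\lambda I$. $\mathrm{SOT}$: $T_i\to T$ iff $\|T_ix-Tx\|\to0$ for every $x\in X$. ''A typical $T\in(\mathcal{P}_1(X),\mathrm{SOT})$ has property (P)'' means that the set of $T\in\mathcal{P}_1(X)$ with (P) is comeager, i.e. contains a dense $G_\delta$ subset of $(\mathcal{P}_1(X),\mathrm{SOT})$. *)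

(* Defs.v *)
From HB Require Import structures.
From mathcomp Require Import all_boot all_order all_algebra.
From mathcomp Require Import all_classical all_reals all_analysis.
From mathcomp Require Import borel_hierarchy.
From mathcomp Require Export complex.

Set Implicit Arguments.
Unset Strict Implicit.
Unset Printing Implicit Defensive.

Import Order.TTheory GRing.Theory Num.Theory.
Import numFieldNormedType.Exports.

Local Open Scope classical_set_scope.
Local Open Scope ring_scope.
Local Open Scope complex_scope.

(* A [normedModType R[i]] has its norm in [R[i]]; the norm is real and
   nonnegative there, so [Re `|x|] is the usual real number ||x||. *)

Section Modulus.
Context {R : rcfType}.

Lemma normc_ge0 (z : R[i]) : 0 <= Normc.normc z.
Proof. by rewrite -lecR; exact: (normr_ge0 z). Qed.

Lemma norm_Re {V : normedModType R[i]} (x : V) : `|x| = (complex.Re `|x|)%:C.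
Proof. by rewrite RRe_real// ger0_real. Qed.

Lemma ge0_Re {V : normedModType R[i]} (x : V) : 0 <= complex.Re `|x|.
Proof. by rewrite -ler0c -norm_Re. Qed.

End Modulus.

Section L1.
Context {R : realType}.
Implicit Types (x y : nat -> R[i]) (a : R[i]).

Definition l1_enorm x : \bar R :=
  (\sum_(0 <= n <oo) (Normc.normc (x n))%:E)%E.

Definition l1_pred : {pred nat -> R[i]} :=
  fun x => (l1_enorm x < +oo)%E.

Lemma l1_enorm_ge0 x : (0 <= l1_enorm x)%E.
Proof. by apply: nneseries_ge0 => n _ _; rewrite lee_fin normc_ge0. Qed.

Lemma l1_enormD x y : (l1_enorm (x + y)%R <= l1_enorm x + l1_enorm y)%E.
Proof.
rewrite /l1_enorm -nneseriesD; try by move=> n _ _; rewrite lee_fin normc_ge0.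
by apply: lee_nneseries => n _; rewrite ?lee_fin ?normc_ge0 ?le_normcD.
Qed.

Lemma l1_enormZ a x : l1_enorm (a *: x)%R = ((Normc.normc a)%:E * l1_enorm x)%E.
Proof.
rewrite /l1_enorm -nneseriesZl; last by move=> n _; rewrite lee_fin normc_ge0.
by apply: eq_eseriesr => n _; rewrite -EFinM -Normc.normcM.
Qed.

Lemma l1_enorm0 : l1_enorm 0 = 0%E.
Proof. by apply: eseries0 => n _ _; rewrite Normc.normc0. Qed.

Lemma l1_submod_closed : submod_closed l1_pred.
Proof.
split=> [|a x y]; rewrite /l1_pred !unfold_in ?l1_enorm0 // => fx fy.
apply: (le_lt_trans (l1_enormD _ _)); rewrite lte_add_pinfty // l1_enormZ.
by rewrite lte_mul_pinfty // lee_fin normc_ge0.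
Qed.

HB.instance Definition _ := GRing.isSubmodClosed.Build R[i] (nat -> R[i])
  l1_pred l1_submod_closed.

End L1.

Record l1 (R : realType) := L1 {
  l1_coord :> nat -> R[i];
  l1_coordP : l1_coord \in l1_pred }.

Section L1Normed.
Context {R : realType}.

HB.instance Definition _ := [isSub for @l1_coord R].
HB.instance Definition _ := [Choice of l1 R by <:].
HB.instance Definition _ := [SubChoice_isSubLmodule of l1 R by <:].

Implicit Types x y : l1 R.

Definition l1_norm x : R[i] := (fine (l1_enorm x))%:C.

Lemma l1_fin_num x : l1_enorm x \is a fin_num.
Proof. by rewrite ge0_fin_numE ?l1_enorm_ge0 //; exact: l1_coordP. Qed.

Lemma l1_normD x y : l1_norm (x + y) <= l1_norm x + l1_norm y.
Proof.
rewrite -rmorphD lecR /= -fineD ?l1_fin_num // fine_le ?l1_enormD //.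
- exact: (l1_fin_num (x + y)).
- by rewrite fin_numD !l1_fin_num.
Qed.

Lemma l1_normZ (a : R[i]) x : l1_norm (a *: x) = `|a| * l1_norm x.
Proof.
by rewrite /l1_norm [l1_enorm _]l1_enormZ fineM ?l1_fin_num // rmorphM.
Qed.

Lemma l1_norm_eq0 x : l1_norm x = 0 -> x = 0.
Proof.
move=> /complexI x0; apply/val_inj/funext => n /=.
have : ((Normc.normc (x n))%:E <= l1_enorm x)%E.
  rewrite /l1_enorm (@nneseriesD1 _ _ n) //; last first.
    by move=> k; rewrite lee_fin normc_ge0.
  by rewrite leeDl // nneseries_ge0 // => k _ _; rewrite lee_fin normc_ge0.
rewrite -(fineK (l1_fin_num x)) x0 lee_fin => xn0.
by apply: Normc.eq0_normc; apply/eqP; rewrite eq_le xn0 normc_ge0.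
Qed.

HB.instance Definition _ := Lmodule_isNormed.Build R[i] (l1 R)
  l1_normD l1_normZ l1_norm_eq0.

End L1Normed.

Section BoundedPred.
Context {R : realType} {X Y : normedModType R[i]}.
Implicit Types f g : X -> Y.

Definition bounded_linear_pred : {pred X -> Y} :=
  fun f => `[< linear f /\ bounded_near f (nbhs (0 : X)) >].

Lemma bounded_linearP f : f \in bounded_linear_pred <->
  linear f /\ exists2 M : R, 0 <= M & forall x, `|f x| <= M%:C * `|x|.
Proof.
split.
  rewrite unfold_in => /asboolP[lf].
  pose g : {linear X -> Y} := HB.pack f (GRing.isLinear.Build _ _ _ _ _ lf).
  move=> /(linear_boundedP g)/pinfty_ex_gt0[M M0 Mf]; split => //.
  exists (complex.Re M).
    by rewrite -lecR RRe_real ?gtr0_real //; exact: ltW.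
  by move=> x; rewrite RRe_real ?gtr0_real //; exact: Mf.
move=> [lf [M M0 Mf]]; rewrite unfold_in; apply/asboolP; split => //.
pose g : {linear X -> Y} := HB.pack f (GRing.isLinear.Build _ _ _ _ _ lf).
apply/(linear_boundedP g); exists M%:C; split; first by rewrite ger0_real ?ler0c.
move=> r Mr x; apply: (le_trans (Mf x)).
by rewrite ler_wpM2r // ltW.
Qed.

Lemma bounded_linear_submod_closed : submod_closed bounded_linear_pred.
Proof.
split=> [|a f g /bounded_linearP[lf [M M0 fM]] /bounded_linearP[lg [N N0 gN]]];
  apply/bounded_linearP; split.
- by move=> b x y; rewrite /= scaler0 addr0.
- by exists 0 => // x; rewrite /= normr0 mul0r.
- move=> b x y; rewrite !fctE lf lg !scalerDr !scalerA [a * b]mulrC.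
  by rewrite addrACA.
- exists (Normc.normc a * M + N); first by rewrite addr_ge0 ?mulr_ge0 ?normc_ge0.
  move=> x; rewrite !fctE rmorphD rmorphM /= mulrDl.
  rewrite (le_trans (ler_normD _ _)) // lerD // normrZ -mulrA.
  by rewrite ler_wpM2l.
Qed.

HB.instance Definition _ := GRing.isSubmodClosed.Build R[i] (X -> Y)
  bounded_linear_pred bounded_linear_submod_closed.

End BoundedPred.

Record blop (R : realType) (X Y : normedModType R[i]) := Blop {
  blop_fun :> X -> Y;
  blop_funP : blop_fun \in bounded_linear_pred }.

Section BoundedOperators.
Context {R : realType} {X Y : normedModType R[i]}.

HB.instance Definition _ := [isSub for @blop_fun R X Y].
HB.instance Definition _ := [Choice of blop X Y by <:].
HB.instance Definition _ := [SubChoice_isSubLmodule of blop X Y by <:].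

Implicit Types f g : blop X Y.

Lemma blop_linear f : linear f.
Proof. by have /bounded_linearP[] := blop_funP f. Qed.

HB.instance Definition _ f :=
  GRing.isLinear.Build R[i] X Y *:%R (blop_fun f) (@blop_linear f).

Definition op_norm f : R[i] :=
  (sup [set complex.Re `|f x| | x in [set x : X | `|x| <= 1]])%:C.

Lemma op_norm_ub f x : `|x| <= 1 -> `|f x| <= op_norm f.
Proof.
move=> x1; rewrite norm_Re lecR; apply: ub_le_sup; last by exists x.
have /bounded_linearP[_ [M M0 fM]] := blop_funP f.
exists M => _ [y /= y1 <-]; rewrite -lecR -norm_Re (le_trans (fM y)) //.
by rewrite ler_piMr ?ler0c.
Qed.

Lemma op_norm_le f (M : R) :
  (forall x, `|x| <= 1 -> `|f x| <= M%:C) -> op_norm f <= M%:C.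
Proof.
move=> fM; rewrite lecR; apply: ge_sup.
  by exists (complex.Re `|f 0|), 0 => //=; rewrite normr0.
by move=> _ [x /= x1 <-]; rewrite -lecR -norm_Re fM.
Qed.

Lemma op_norm_ge0 f : 0 <= op_norm f.
Proof. by rewrite (le_trans _ (@op_norm_ub f 0 _)) ?normr0. Qed.

Lemma op_norm_bound f x : `|f x| <= op_norm f * `|x|.
Proof.
have [->|x0] := eqVneq x 0; first by rewrite raddf0 !normr0 mulr0.
rewrite -ler_pdivrMr ?normr_gt0 // mulrC.
rewrite -[X in X * _]ger0_norm ?invr_ge0 // -normrZ -linearZ /= op_norm_ub //.
by rewrite normrZ ger0_norm ?invr_ge0 // mulVf ?normr_eq0.
Qed.

Lemma op_normD f g : op_norm (f + g) <= op_norm f + op_norm g.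
Proof.
rewrite -rmorphD; apply: op_norm_le => x x1; rewrite rmorphD.
by rewrite (le_trans (ler_normD _ _)) // lerD // op_norm_ub.
Qed.

Lemma op_normZ_le (a : R[i]) f : op_norm (a *: f) <= `|a| * op_norm f.
Proof.
rewrite -[`|a|]/((Normc.normc a)%:C) -rmorphM; apply: op_norm_le => x x1.
by rewrite rmorphM [`|_|]normrZ ler_wpM2l ?op_norm_ub.
Qed.

Lemma op_norm_eq0 f : op_norm f = 0 -> f = 0.
Proof.
move=> f0; apply/val_inj/funext => x /=; apply/eqP; rewrite -normr_le0.
by rewrite (le_trans (op_norm_bound f x)) // f0 mul0r.
Qed.

Lemma op_normZ (a : R[i]) f : op_norm (a *: f) = `|a| * op_norm f.
Proof.
apply/eqP; rewrite eq_le op_normZ_le /=.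
have [->|a0] := eqVneq a 0; first by rewrite normr0 mul0r op_norm_ge0.
rewrite -ler_pdivlMl ?normr_gt0 // -normfV.
by rewrite -[in leLHS](scalerK a0 f) op_normZ_le.
Qed.

HB.instance Definition _ := Lmodule_isNormed.Build R[i] (blop X Y)
  op_normD op_normZ op_norm_eq0.

Lemma blopDE f g x : (f + g) x = f x + g x. Proof. by []. Qed.

Lemma blopNE f x : (- f) x = - f x. Proof. by []. Qed.

Lemma blopZE (a : R[i]) f x : (a *: f) x = a *: f x. Proof. by []. Qed.

Lemma blop_normE f : `|f| = op_norm f. Proof. by []. Qed.

End BoundedOperators.

Section Composition.
Context {R : realType} {X Y Z : normedModType R[i]}.

Lemma blop_id_subproof : (idfun : X -> X) \in bounded_linear_pred.
Proof.
apply/bounded_linearP; split => //; exists 1 => // x.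
by rewrite rmorph1 mul1r.
Qed.

Definition blop_id : blop X X := Blop blop_id_subproof.

Lemma blop_comp_subproof (g : blop Y Z) (f : blop X Y) :
  g \o f \in bounded_linear_pred.
Proof.
have [_ [M M0 gM]] := (bounded_linearP g).1 (blop_funP g).
have [_ [N N0 fN]] := (bounded_linearP f).1 (blop_funP f).
apply/bounded_linearP; split; first by move=> a x y /=; rewrite !linearP.
exists (M * N); first exact: mulr_ge0.
move=> x; rewrite rmorphM -mulrA (le_trans (gM _)) //.
by rewrite ler_wpM2l ?ler0c.
Qed.

Definition blop_comp (g : blop Y Z) (f : blop X Y) : blop X Z :=
  Blop (blop_comp_subproof g f).

End Composition.

Definition dual (R : realType) (X : normedModType R[i]) := blop X R[i]^o.

Definition adjoint (R : realType) (X Y : normedModType R[i]) (T : blop X Y) :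
  dual Y -> dual X := fun phi => blop_comp phi T.

Definition is_isometry (R : realType) (X Y : normedModType R[i]) (f : X -> Y) :=
  forall x y, `|f x - f y| = `|x - y|.

(* An alias of [blop X X], which itself carries the operator norm topology. *)
Definition sot (R : realType) (X : normedModType R[i]) :=
  initial_topology (fun T : blop X X => (T : X -> X) : {ptws X -> X}).

Section SotTheory.
Context {R : realType} {X : normedModType R[i]}.

Definition sot_eval (x : X) (T : sot X) : X := (T : blop X X) x.

Lemma sot_eval_continuous (x : X) : continuous (sot_eval x).
Proof.
move=> T; apply: (@continuous_comp (sot X) {ptws X -> X} X
  (fun S => (S : blop X X) : X -> X) (fun f => f x)).
- exact: initial_continuous.
- exact: (@proj_continuous _ (fun=> X)).
Qed.

Lemma sot_cvgP (F : set_system (sot X)) (T : sot X) : Filter F ->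
  F --> T <-> forall x, `|sot_eval x S - sot_eval x T| @[S --> F] --> (0 : R[i]^o).
Proof.
move=> FF; split=> [FT x|FT].
  apply/(@norm_cvg0P _ _ _ F FF)/(@subr_cvg0 _ _ _ F FF).
  have := @sot_eval_continuous x T.
  by move=> h; apply: (cvg_comp _ _ FT h).
move=> U; rewrite nbhsE => -[_ [[B oB <-] BT] /filterS]; apply.
have: (fun S : sot X => ((S : blop X X) : X -> X)) @ F -->
    (((T : blop X X) : X -> X) : {ptws X -> X}).
  apply/cvg_sup => x V [_ [[W oW <-] WT] /filterS]; apply.
  have /(@norm_cvg0P _ _ _ F FF)/(@subr_cvg0 _ _ _ F FF) := FT x.
  by apply; exact: open_nbhs_nbhs.
by apply; exact: open_nbhs_nbhs.
Qed.

End SotTheory.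

Section PositiveContractions.
Context {R : realType}.

(* In [R[i]], [0 <= z] means that z is real and nonnegative. *)
Definition positive_vector (x : l1 R) := forall n, 0 <= x n.

Definition positive_operator (T : blop (l1 R) (l1 R)) :=
  forall x, positive_vector x -> positive_vector (T x).

Definition positive_contractions : set (sot (l1 R)) :=
  [set T : blop (l1 R) (l1 R) | positive_operator T /\ `|T| <= 1].

(* The set [positive_contractions], coerced to a type, carries the topology
   induced by [sot (l1 R)]; open, dense and G_delta are relative to it. *)
Definition typical_positive_contraction (P : blop (l1 R) (l1 R) -> Prop) :=
  exists G : set positive_contractions,
    [/\ Gdelta G, dense G & forall T, G T -> P (set_val T)].

End PositiveContractions.

(* Main.v *)
Require Import Defs.
From HB Require Import structures.
From mathcomp Require Import all_boot all_order all_algebra.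
From mathcomp Require Import all_classical all_reals all_analysis.
From mathcomp Require Import ring lra zify.

Set Implicit Arguments.
Unset Strict Implicit.
Unset Printing Implicit Defensive.

Import Order.TTheory GRing.Theory Num.Theory.
Import numFieldNormedType.Exports.

Local Open Scope classical_set_scope.
Local Open Scope ring_scope.
Local Open Scope complex_scope.

(** Write [e_k] for the basis of ell_1.  The typical property is that every
    [e_k] is approximated arbitrarily well by two different columns [T e_i] and
    [T e_j] of [T] ([columns_approximate_twice]).

    It is a G_delta condition, since each column depends SOT-continuously on
    [T].  It is dense by an explicit perturbation: keep the first [N] columns of
    a positive contraction [T] and let the remaining columns run through
    [e_0, e_0, e_1, e_1, e_2, ...].  The operator [glue T N] so obtained is a
    positive contraction with the property, and it tends to [T] in the SOT
    because the two operators differ only on the tail of a vector.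

    The three conclusions follow.  If [y] is truncated to finitely many
    coordinates and each [e_k] is replaced by an index whose column is close to
    [e_k], one gets [x] with [|x| <= |y|] and [T x] as close to [y] as desired
    ([columns_lift_approximately]).
    - Hence [|phi o T| = |phi|] for every functional [phi]
      ([adjoint_isometry]).
    - For [|lambda| < 1], such an [x] solves [(T - lambda) x = y] with an error
      of at most [q |y|], where [q < 1]; iterating on the error gives a
      geometric series of corrections whose sum is an exact solution
      ([surj_subr_scalar]).  The sum exists because ell_1 is complete
      ([l1_Cauchy]).
    - Two columns [T e_i], [T e_j] at distance less than 1 prevent the i-th
      coordinate functional from being [psi o T]: the isometry would force
      [|psi| <= 1], while [psi (T e_i - T e_j) = 1] ([adjoint_not_surj]). *)

(** * Real-valued norms *)

Section RealNorm.
Context {R : realType}.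

(** The norm takes its values in [R[i]], whose order is partial; its real part
    lives in [R], where linear arithmetic is available. *)
Definition rnorm (V : normedModType R[i]) (x : V) : R := complex.Re `|x|.

Lemma rnormE (V : normedModType R[i]) (x : V) : `|x| = (rnorm x)%:C.
Proof. exact: norm_Re. Qed.

Lemma rnorm_ge0 (V : normedModType R[i]) (x : V) : 0 <= rnorm x.
Proof. exact: ge0_Re. Qed.

Lemma rnormD (V : normedModType R[i]) (x y : V) :
  rnorm (x + y) <= rnorm x + rnorm y.
Proof. by rewrite -lecR rmorphD /= -!rnormE ler_normD. Qed.

Lemma rnormZ (V : normedModType R[i]) (a : R[i]) (x : V) :
  rnorm (a *: x) = Normc.normc a * rnorm x.
Proof. by apply: complexI; rewrite rmorphM /= -!rnormE normrZ. Qed.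

Lemma rnorm0 (V : normedModType R[i]) : rnorm (0 : V) = 0.
Proof. by rewrite /rnorm normr0. Qed.

Lemma rnorm0_eq0 (V : normedModType R[i]) (x : V) : rnorm x <= 0 -> x = 0.
Proof. by move=> x0; apply/eqP; rewrite -normr_le0 rnormE lecR. Qed.

Lemma rnormB (V : normedModType R[i]) (x y : V) : rnorm (x - y) = rnorm (y - x).
Proof. by rewrite /rnorm distrC. Qed.

Lemma rnorm_sum (V : normedModType R[i]) n (F : nat -> V) :
  rnorm (\sum_(k < n) F k) <= \sum_(k < n) rnorm (F k).
Proof.
elim: n => [|n IH]; first by rewrite !big_ord0 rnorm0.
by rewrite !big_ord_recr /= (le_trans (rnormD _ _)) // lerD2r.
Qed.

Lemma blop0 (X Y : normedModType R[i]) (T : blop X Y) : T 0 = 0.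
Proof. exact: linear0. Qed.

Lemma blopD (X Y : normedModType R[i]) (T : blop X Y) x y :
  T (x + y) = T x + T y.
Proof. exact: linearD. Qed.

Lemma blopB (X Y : normedModType R[i]) (T : blop X Y) x y :
  T (x - y) = T x - T y.
Proof. exact: linearB. Qed.

Lemma blop_comb (X Y : normedModType R[i]) (T : blop X Y) N
    (a : nat -> R[i]) (x : nat -> X) :
  T (\sum_(k < N) a k *: x k) = \sum_(k < N) a k *: T (x k).
Proof. by rewrite linear_sum; apply: eq_bigr => k _; exact: linearZ. Qed.

Lemma rnorm_op (X Y : normedModType R[i]) (T : blop X Y) (x : X) :
  rnorm (T x) <= rnorm T * rnorm x.
Proof. by rewrite -lecR rmorphM /= -!rnormE op_norm_bound. Qed.

Lemma rnorm_op_le (X Y : normedModType R[i]) (T : blop X Y) (M : R) :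
  0 <= M -> (forall x, rnorm (T x) <= M * rnorm x) -> rnorm T <= M.
Proof.
move=> M0 TM; rewrite -lecR -rnormE; apply: op_norm_le => x.
rewrite !rnormE !lecR => x1; apply: (le_trans (TM x)).
by rewrite ler_piMr.
Qed.

End RealNorm.

(** * Coordinates, tails and truncations in ell_1 *)

Section L1Coordinates.
Context {R : realType}.
Implicit Types (x y : l1 R).

Lemma l1_coordB x y n : l1_coord (x - y) n = x n - y n. Proof. by []. Qed.

(** The norm is the supremum of the partial sums, so every bound on an ell_1
    norm below reduces to finite sums through this lemma. *)
Lemma le_enorm_l1 (x : nat -> R[i]) (M : R) :
  (forall K, \sum_(k < K) Normc.normc (x k) <= M) -> (l1_enorm x <= M%:E)%E.
Proof.
move=> xM; apply: lime_le.
  by apply: is_cvg_nneseries => n _ _; rewrite lee_fin normc_ge0.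
by apply: nearW => K; rewrite sumEFin lee_fin big_mkord.
Qed.

Lemma l1_of_bounded_sums (x : nat -> R[i]) (M : R) :
  (forall K, \sum_(k < K) Normc.normc (x k) <= M) -> x \in l1_pred.
Proof.
move=> xM; rewrite unfold_in; apply: (le_lt_trans (le_enorm_l1 xM)).
exact: ltry.
Qed.

Lemma rnorm_l1_le x (M : R) :
  (forall K, \sum_(k < K) Normc.normc (x k) <= M) -> rnorm x <= M.
Proof. by move=> /le_enorm_l1; rewrite -lee_fin fineK // l1_fin_num. Qed.

Lemma sum_le_rnorm x K : \sum_(k < K) Normc.normc (x k) <= rnorm x.
Proof.
rewrite -lee_fin fineK ?l1_fin_num //.
apply: (le_trans _ (@nneseries_lim_ge _ _ xpredT 0%N K _)).
  by rewrite sumEFin big_mkord.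
by move=> n _ _; rewrite lee_fin normc_ge0.
Qed.

Lemma normc_le_rnorm x n : Normc.normc (x n) <= rnorm x.
Proof.
apply: le_trans (sum_le_rnorm x n.+1); rewrite big_ord_recr /= lerDr.
by apply: sumr_ge0 => k _; exact: normc_ge0.
Qed.

Lemma ler_sum_normc (x : nat -> R[i]) m n : (m <= n)%N ->
  \sum_(k < m) Normc.normc (x k) <= \sum_(k < n) Normc.normc (x k).
Proof.
move=> /subnKC <-; rewrite big_split_ord /= lerDl.
by apply: sumr_ge0 => k _; exact: normc_ge0.
Qed.

(** The mass carried by the coordinates from [N] on, expressed without a second
    infinite sum. *)
Definition tail x N : R := rnorm x - \sum_(k < N) Normc.normc (x k).

(** Otherwise all partial sums, hence also the norm, would be at most
    [rnorm x - e]. *)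
Lemma tail_small x (e : R) : 0 < e ->
  exists N, forall n, (N <= n)%N -> tail x n < e.
Proof.
move=> e0; apply: contrapT => /forallNP ex.
have : rnorm x <= rnorm x - e; last by lra.
apply: rnorm_l1_le => K; have /existsNP[n /not_implyP[Kn /negP]] := ex K.
rewrite -leNgt /tail => le; apply: le_trans (ler_sum_normc x Kn) _; lra.
Qed.

Lemma coord_subproof n :
  ((fun x => x n) : l1 R -> R[i]^o) \in bounded_linear_pred.
Proof.
apply/bounded_linearP; split=> //; exists 1 => // x.
by rewrite mul1r rnormE lecR normc_le_rnorm.
Qed.

(** Coordinates as bounded functionals: they commute with finite sums, and they
    are the functionals used against surjectivity of the adjoint. *)
Definition coord n : dual (l1 R) := Blop (coord_subproof n).

Lemma coordE n x : coord n x = x n. Proof. by []. Qed.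

Lemma rnorm_coord_le1 n : rnorm (coord n) <= 1.
Proof. by apply: rnorm_op_le => // x; rewrite mul1r normc_le_rnorm. Qed.

Lemma sum_basis_le1 j K :
  \sum_(k < K) Normc.normc ((k == j :> nat)%:R : R[i]) <= 1.
Proof.
have [jK|Kj] := ltnP j K.
  rewrite (bigD1 (Ordinal jK)) //= eqxx Normc.normc1 big1 ?addr0 // => i.
  by rewrite -val_eqE /= => /negbTE ->; rewrite Normc.normc0.
rewrite big1 // => i _; rewrite ltn_eqF ?Normc.normc0 //.
exact: leq_trans (ltn_ord i) Kj.
Qed.

Definition basis j : l1 R :=
  @L1 R (fun n => (n == j)%:R) (l1_of_bounded_sums (sum_basis_le1 j)).

Lemma basisE j n : basis j n = (n == j)%:R. Proof. by []. Qed.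

Lemma rnorm_basis_le1 j : rnorm (basis j) <= 1.
Proof. by apply: rnorm_l1_le => K; exact: sum_basis_le1. Qed.

Lemma rnorm_comb_le (V : normedModType R[i]) x N (v : nat -> V) (M : R) :
  (forall j, rnorm (v j) <= M) ->
  rnorm (\sum_(j < N) x j *: v j) <= M * \sum_(j < N) Normc.normc (x j).
Proof.
move=> vM; apply: le_trans (rnorm_sum _ (fun j => x j *: v j)) _.
rewrite mulr_sumr; apply: ler_sum => j _.
by rewrite rnormZ mulrC ler_wpM2r ?normc_ge0.
Qed.

Definition trunc N x : l1 R := \sum_(j < N) x j *: basis j.

Lemma truncE N x n : trunc N x n = if (n < N)%N then x n else 0.
Proof.
rewrite -coordE blop_comb.
rewrite (eq_bigr (fun j : 'I_N => x j * (n == j :> nat)%:R)) //.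
have [nN|Nn] := ltnP n N.
  rewrite (bigD1 (Ordinal nN)) //= eqxx mulr1 big1 ?addr0 // => i.
  by rewrite -val_eqE /= eq_sym => /negbTE ->; rewrite mulr0.
rewrite big1 // => i _; rewrite gtn_eqF ?mulr0 //.
exact: leq_trans (ltn_ord i) Nn.
Qed.

(** The first [K] coordinates are enlarged to the first [N + K], so that they
    split into [N] coordinates that vanish and [K] that agree with [x]. *)
Lemma rnorm_subr_trunc N x : rnorm (x - trunc N x) <= tail x N.
Proof.
apply: rnorm_l1_le => K; rewrite /tail lerBrDr.
apply: le_trans (sum_le_rnorm x (N + K)).
apply: (@le_trans _ _ (\sum_(k < N + K) Normc.normc (l1_coord (x - trunc N x) k)
   + \sum_(k < N) Normc.normc (x k))).
  by rewrite lerD2r ler_sum_normc // leq_addl.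
under eq_bigr do rewrite l1_coordB truncE.
rewrite !big_split_ord [X in X + _ + _]big1 ?add0r /=; last first.
  by move=> i _; rewrite ltn_ord subrr Normc.normc0.
rewrite [leLHS]addrC lerD // ler_sum // => i _.
by rewrite ltnNge leq_addr subr0.
Qed.

End L1Coordinates.

(** * Completeness of ell_1 *)

Section Completeness.
Context {R : realType}.

(** The intervals [[u m - b m, u m + b m]] pairwise intersect, so the supremum
    of their left ends lies in all of them.  The explicit modulus [b] gives an
    error bound for each term. *)
Lemma real_Cauchy (u b : nat -> R) :
  (forall m p, `|u (m + p)%N - u m| <= b m) ->
  exists s, forall m, `|s - u m| <= b m.
Proof.
move=> ub.
have cross m n : u m - b m <= u n + b n.
  have b0 k : 0 <= b k by apply: le_trans (ub k 0%N).
  have [/subnKC E|/ltnW/subnKC E] := leqP m n.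
    have := ub m (n - m)%N; rewrite E ler_norml => /andP[h _].
    have := b0 n; lra.
  have := ub n (m - n)%N; rewrite E ler_norml => /andP[_ h].
  have := b0 m; lra.
pose A := [set u m - b m | m in [set: nat]].
exists (sup A) => m; rewrite ler_norml; apply/andP; split.
  rewrite lerBrDr addrC; apply: ub_le_sup; last by exists m.
  by exists (u 0%N + b 0%N) => _ [n _ <-]; exact: cross.
rewrite lerBlDr addrC; apply: ge_sup; first by exists (u 0%N - b 0%N), 0%N.
by move=> _ [n _ <-]; exact: cross.
Qed.

Lemma normc_le_ReIm (z : R[i]) :
  Normc.normc z <= `|complex.Re z| + `|complex.Im z|.
Proof.
case: z => a b /=; rewrite -(ger0_norm (addr_ge0 (normr_ge0 a) (normr_ge0 b))).
rewrite -sqrtr_sqr ler_wsqrtr // sqrrD !real_normK ?num_real //.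
by rewrite lerD2r lerDl mulrn_wge0 ?mulr_ge0.
Qed.

Lemma normr_Re_le (z : R[i]) : `|complex.Re z| <= Normc.normc z.
Proof.
by case: z => a b /=; rewrite -sqrtr_sqr ler_wsqrtr // lerDl sqr_ge0.
Qed.

Lemma normr_Im_le (z : R[i]) : `|complex.Im z| <= Normc.normc z.
Proof.
by case: z => a b /=; rewrite -sqrtr_sqr ler_wsqrtr // lerDr sqr_ge0.
Qed.

Lemma complex_Cauchy (z : nat -> R[i]) (b : nat -> R) :
  (forall m p, Normc.normc (z (m + p)%N - z m) <= b m) ->
  exists s, forall m, Normc.normc (s - z m) <= 2 * b m.
Proof.
move=> zb.
have [|s sP] := @real_Cauchy (fun n => complex.Re (z n)) b.
  by move=> m p; rewrite -raddfB (le_trans (normr_Re_le _)).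
have [|t tP] := @real_Cauchy (fun n => complex.Im (z n)) b.
  by move=> m p; rewrite -raddfB (le_trans (normr_Im_le _)).
exists (s +i* t) => m; apply: le_trans (normc_le_ReIm _) _.
by rewrite !raddfB /= mulr_natl mulr2n lerD.
Qed.

(** The limit [s] is taken coordinate by coordinate, where only the bound
    [2 * b m] is known.  On the first [K] coordinates, passing through a later
    term [S (m + p)] costs [2 * K * b (m + p)], which is arbitrarily small; so
    the partial sums of [s - S m] are bounded by [b m] itself, uniformly in
    [K]. *)
Lemma l1_Cauchy (S : nat -> l1 R) (b : nat -> R) :
  (forall m p, rnorm (S (m + p)%N - S m) <= b m) ->
  (forall e m, 0 < e -> exists p, b (m + p)%N <= e) ->
  exists s, forall m, rnorm (s - S m) <= b m.
Proof.
move=> Sb b_small.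
have /choice[s sP] : forall k, exists s, forall m,
    Normc.normc (s - S m k) <= 2 * b m.
  move=> k; apply: complex_Cauchy => m p.
  by apply: le_trans (Sb m p); rewrite -l1_coordB normc_le_rnorm.
have sum_le m K : \sum_(k < K) Normc.normc (s k - S m k) <= b m.
  apply/ler_addgt0Pr => e e0.
  have [|p bp] := b_small (e / (2 * K.+1%:R)) m; first by rewrite divr_gt0.
  apply: (@le_trans _ _ (\sum_(k < K) (2 * b (m + p)%N)
      + \sum_(k < K) Normc.normc (l1_coord (S (m + p)%N - S m) k))).
    rewrite -big_split /= ler_sum // => k _.
    have -> : s k - S m k =
        (s k - S (m + p)%N k) + (S (m + p)%N k - S m k) by rewrite addrA subrK.
    by rewrite (le_trans (le_normcD _ _)) // lerD2r.
  rewrite addrC lerD ?(le_trans (sum_le_rnorm _ _)) //.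
  rewrite sumr_const card_ord -[leLHS]mulr_natr.
  have : 2 * b (m + p)%N * K.+1%:R <= e.
    by move: bp; rewrite ler_pdivlMr //; set c : R := K.+1%:R; lra.
  apply: le_trans; rewrite ler_wpM2l ?ler_nat // mulr_ge0 //.
  exact: le_trans (rnorm_ge0 _) (Sb _ 0%N).
have s_l1 K : \sum_(k < K) Normc.normc (s k) <= b 0%N + rnorm (S 0%N).
  apply: le_trans (lerD (sum_le 0%N K) (sum_le_rnorm _ K)).
  rewrite -big_split ler_sum // => k _ /=.
  by rewrite -{1}(subrK (S 0%N k) (s k)) le_normcD.
exists (L1 (l1_of_bounded_sums s_l1)) => m.
by apply: rnorm_l1_le => K; exact: sum_le.
Qed.

Lemma geometric_small (A q e : R) : 0 <= q < 1 -> 0 < e ->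
  exists N, forall n, (N <= n)%N -> A * q ^+ n <= e.
Proof.
move=> /andP[q0 q1] e0.
have : A * q ^+ n @[n --> \oo] --> 0.
  by apply: cvg_geometric; rewrite ger0_norm.
move=> /cvgr0Pnorm_le/(_ _ e0)[N _ NP]; exists N => n Nn.
by apply: le_trans (ler_norm _) _; exact: NP.
Qed.

Lemma l1_geometric (x : nat -> l1 R) (C q : R) : 0 <= C -> 0 <= q < 1 ->
  (forall n, rnorm (x n) <= C * q ^+ n) ->
  exists s, forall m,
    rnorm (s - \sum_(n < m) x n) <= C / (1 - q) * q ^+ m.
Proof.
move=> C0 /andP[q0 q1] xC; have q'0 : 0 < 1 - q by rewrite subr_gt0.
apply: l1_Cauchy => [m p|e m e0]; last first.
  have [|N NP] := @geometric_small (C / (1 - q)) q e _ e0; first by rewrite q0.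
  by exists N; apply: NP; rewrite leq_addl.
apply: (@le_trans _ _ (C / (1 - q) * (q ^+ m - q ^+ (m + p)))); last first.
  by rewrite ler_wpM2l ?divr_ge0 ?(ltW q'0) // lerBlDr lerDl exprn_ge0.
(* The bound on a block of terms telescopes exactly. *)
elim: p => [|p IH]; first by rewrite addn0 !subrr rnorm0 mulr0.
rewrite addnS big_ord_recr /= addrAC (le_trans (rnormD _ _)) //.
apply: le_trans (lerD IH (xC _)) _.
by rewrite le_eqVlt; apply/orP; left; apply/eqP; rewrite exprS; field; lra.
Qed.

(** * Surjectivity from approximate solutions *)

(** An approximate solver [g] is iterated on the residual [Y n], which decays
    like [q ^+ n]; so do the corrections [g (Y n)], and their sum solves the
    equation. *)
Lemma surj_of_approx_solutions (D : blop (l1 R) (l1 R)) (q : R) :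
  0 <= q < 1 ->
  (forall y, exists x, rnorm x <= rnorm y /\ rnorm (y - D x) <= q * rnorm y) ->
  set_surj setT setT D.
Proof.
move=> q01 /choice[g gP] y _; have /andP[q0 q1] := q01.
pose Y n := iter n (fun z => z - D (g z)) y.
have Yq n : rnorm (Y n) <= rnorm y * q ^+ n.
  elim: n => [|n IH]; first by rewrite mulr1.
  apply: le_trans (gP _).2 _.
  by rewrite exprS mulrCA ler_wpM2l.
have gq n : rnorm (g (Y n)) <= rnorm y * q ^+ n.
  exact: le_trans (gP _).1 (Yq n).
have [s sP] := l1_geometric (rnorm_ge0 y) q01 gq.
exists s => //; apply/eqP; rewrite -subr_eq0; apply/eqP/rnorm0_eq0.
have DS m : D (\sum_(n < m) g (Y n)) = y - Y m.
  elim: m => [|m IH]; first by rewrite big_ord0 subrr blop0.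
  by rewrite big_ord_recr /= blopD IH /= opprB addrA addrAC.
apply/ler_addgt0Pr => e e0; rewrite add0r.
have [N NP] :=
  @geometric_small (rnorm D * (rnorm y / (1 - q)) + rnorm y) q e q01 e0.
apply: le_trans (NP N (leqnn N)); rewrite mulrDl -mulrA.
have -> : D s - y = D (s - \sum_(n < N) g (Y n)) - Y N.
  by rewrite blopB DS opprB addrA addrAC addrK.
apply: le_trans (rnormD _ _) _; apply: lerD; last first.
  by rewrite -[X in rnorm X]sub0r rnormB subr0.
by apply: le_trans (rnorm_op _ _) _; rewrite ler_wpM2l // rnorm_ge0.
Qed.

End Completeness.

(** * Operators that lift vectors approximately *)

Section AlmostOnto.
Context {R : realType}.

(** For a contraction this says that the closed unit ball has dense image in the
    closed unit ball. *)
Definition lifts_approximately (X Y : normedModType R[i]) (T : blop X Y) :=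
  forall (y : Y) (e : R), 0 < e ->
    exists x, rnorm x <= rnorm y /\ rnorm (T x - y) <= e.

(** One inequality is [|T| <= 1].  For the other, [f y] is close to [f (T x)]
    for some [x] with [|x| <= |y|]. *)
Lemma adjoint_isometry (X Y : normedModType R[i]) (T : blop X Y) :
  rnorm T <= 1 -> lifts_approximately T -> is_isometry (adjoint T).
Proof.
move=> T1 Tlift phi psi.
have -> : adjoint T phi - adjoint T psi = adjoint T (phi - psi).
  exact/val_inj/funext.
move: (phi - psi) => f {phi psi}; apply/eqP.
rewrite !rnormE (inj_eq (@complexI R)) eq_le; apply/andP; split.
  apply: rnorm_op_le => [|x]; first exact: rnorm_ge0.
  apply: le_trans (rnorm_op f (T x)) _.
  rewrite ler_wpM2l ?rnorm_ge0 // (le_trans (rnorm_op _ _)) //.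
  by rewrite ler_piMl ?rnorm_ge0.
apply: rnorm_op_le => [|y]; first exact: rnorm_ge0.
apply/ler_addgt0Pr => e e0.
have [|x [xy Txy]] := Tlift y (e / (rnorm f + 1)).
  by rewrite divr_gt0 // ltr_wpDl ?rnorm_ge0.
have -> : f y = f (T x) - f (T x - y) by rewrite blopB opprB addrC subrK.
apply: le_trans (rnormD _ _) _; apply: lerD.
  apply: le_trans (rnorm_op (adjoint T f) x) _.
  by rewrite ler_wpM2l ?rnorm_ge0.
rewrite -[X in rnorm X]sub0r rnormB subr0.
apply: le_trans (rnorm_op _ _) _.
apply: (@le_trans _ _ ((rnorm f + 1) * (e / (rnorm f + 1)))).
  by rewrite ler_pM ?rnorm_ge0 // lerDl.
by rewrite mulrC divfK // gt_eqF // ltr_wpDl ?rnorm_ge0.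
Qed.

(** If [T x] is within [e] of [y] and [|x| <= |y|], then [(T - lambda) x] is
    within [e + |lambda| |y|] of [y]; the choice [e = (1 - |lambda|) / 2 * |y|]
    makes this at most [(1 + |lambda|) / 2 * |y|]. *)
Lemma surj_subr_scalar (T : blop (l1 R) (l1 R)) (lambda : R[i]) :
  lifts_approximately T -> `|lambda| < 1 ->
  set_surj setT setT (T - lambda *: blop_id : blop (l1 R) (l1 R)).
Proof.
move=> Tlift; rewrite -[`|_|]/((Normc.normc lambda)%:C) ltcR => l1.
have l0 := normc_ge0 lambda; set l := Normc.normc lambda in l0 l1.
apply: (@surj_of_approx_solutions _ _ ((1 + l) / 2)) => [|y].
  by apply/andP; split; lra.
have := rnorm_ge0 y; rewrite le_eqVlt => /orP[/eqP y0|y0].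
  exists 0; rewrite rnorm0 blop0 subr0 -y0 mulr0; split=> //.
have [|x [xy Txy]] := Tlift y ((1 - l) / 2 * rnorm y).
  by rewrite mulr_gt0 //; lra.
exists x; split=> //.
have -> : y - (T - lambda *: blop_id : blop _ _) x = (y - T x) + lambda *: x.
  transitivity (y - (T x - lambda *: x)); first by [].
  by rewrite opprB addrA addrAC.
apply: le_trans (rnormD _ _) _; rewrite rnormB rnormZ.
have : l * rnorm x <= l * rnorm y by rewrite ler_wpM2l.
rewrite -/l; lra.
Qed.

(** One column near each [basis k] suffices for lifting vectors; the second one
    keeps the adjoint from being surjective. *)
Definition columns_approximate_twice (T : blop (l1 R) (l1 R)) :=
  forall k n, exists i j, [/\ i != j, rnorm (T (basis i) - basis k) < n.+1%:R^-1
    & rnorm (T (basis j) - basis k) < n.+1%:R^-1].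

Lemma small_invn (e : R) : 0 < e -> exists n, n.+1%:R^-1 <= e.
Proof.
move=> e0; exists (Num.truncn e^-1).
rewrite -[leRHS]invrK lef_pV2 ?posrE ?invr_gt0 ?ltr0n //.
by apply/ltW/truncnS_gt.
Qed.

(** Half of the error pays for truncating [y], the other half for replacing each
    [basis k] by the image of [basis (c k)]; the added [1] in the denominator
    covers [y = 0]. *)
Lemma columns_lift_approximately (T : blop (l1 R) (l1 R)) :
  columns_approximate_twice T -> lifts_approximately T.
Proof.
move=> Tcols y e e0.
have [N /(_ N (leqnn N)) NP] := tail_small y (divr_gt0 e0 (ltr0Sn R 1)).
have d0 : 0 < e / 2 / (rnorm y + 1).
  by rewrite !divr_gt0 // ltr_wpDl ?rnorm_ge0.
have [n nP] := small_invn d0.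
have /choice[c cP] : forall k, exists j,
    rnorm (T (basis j) - basis k) <= e / 2 / (rnorm y + 1).
  move=> k; have [i [_ [_ /ltW ik _]]] := Tcols k n.
  by exists i; exact: le_trans ik nP.
exists (\sum_(k < N) y k *: basis (c k)); split.
  apply: le_trans (rnorm_comb_le _ _ (fun k => rnorm_basis_le1 (c k))) _.
  by rewrite mul1r sum_le_rnorm.
rewrite (blop_comb T N y (fun k => basis (c k))).
have -> : \sum_(k < N) y k *: T (basis (c k)) - y =
    \sum_(k < N) y k *: (T (basis (c k)) - basis k) - (y - trunc N y).
  under [in RHS]eq_bigr do rewrite scalerBr.
  by rewrite sumrB opprB addrA subrK.
apply: le_trans (rnormD _ _) _; rewrite [leRHS]splitr; apply: lerD.
  apply: le_trans (rnorm_comb_le _ _ cP) _.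
  rewrite mulrAC ler_pdivrMr ?ltr_wpDl ?rnorm_ge0 //.
  rewrite ler_wpM2l ?divr_ge0 ?(ltW e0) //.
  by apply: le_trans (sum_le_rnorm y N) _; rewrite lerDl.
rewrite -[X in rnorm X]sub0r rnormB subr0.
exact: le_trans (rnorm_subr_trunc _ _) (ltW NP).
Qed.

(** A preimage [psi] of the [i]-th coordinate functional has norm at most 1 by
    isometry, yet takes the value 1 at [T (basis i) - T (basis j)], a vector of
    norm less than 1. *)
Lemma adjoint_not_surj (T : blop (l1 R) (l1 R)) :
  is_isometry (adjoint T) -> columns_approximate_twice T ->
  ~ set_surj setT setT (adjoint T).
Proof.
move=> Tiso Tcols Tsurj.
(* Two columns within 1/2 of [basis 0] are at distance less than 1. *)
have [i [j [ij Ti Tj]]] := Tcols 0%N 1%N.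
have [psi _ psiP] := Tsurj (coord i) I.
have psi1 : rnorm psi <= 1.
  have := Tiso psi 0; rewrite subr0.
  have -> : adjoint T 0 = 0 by exact/val_inj/funext.
  by rewrite psiP subr0 !rnormE => /complexI <-; exact: rnorm_coord_le1.
have psiE x : psi (T x) = coord i x by rewrite -psiP.
have : rnorm (psi (T (basis i) - T (basis j))) = 1.
  rewrite blopB !psiE !coordE !basisE eqxx (negbTE ij) subr0.
  by rewrite /rnorm normr1.
have : rnorm (psi (T (basis i) - T (basis j))) < 1; last by move=> /lt_eqF/eqP.
apply: le_lt_trans (rnorm_op _ _) _.
apply: le_lt_trans (ler_wpM2r (rnorm_ge0 _) psi1) _; rewrite mul1r.
have -> : T (basis i) - T (basis j) =
    (T (basis i) - basis 0) + (basis 0 - T (basis j)).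
  by rewrite addrA subrK.
apply: le_lt_trans (rnormD _ _) _.
by rewrite (rnormB (basis 0)) [ltRHS]splitr !div1r; exact: ltrD Ti Tj.
Qed.

End AlmostOnto.

(** * Density: prescribing the columns from some index on *)

Section Density.
Context {R : realType}.

(** The action on coordinates of the operator that kills [basis j] for [j < N]
    and sends both [basis (N + 2k)] and [basis (N + 2k + 1)] to [basis k]. *)
Definition fold_seq N (x : nat -> R[i]) (k : nat) : R[i] :=
  x (N + k.*2)%N + x (N + k.*2.+1)%N.

Lemma sum_fold_seq_le N (x : l1 R) K :
  \sum_(k < K) Normc.normc (fold_seq N x k) <= tail x N.
Proof.
suff h : \sum_(k < N) Normc.normc (x k)
    + \sum_(k < K) Normc.normc (fold_seq N x k) <=
    \sum_(k < N + K.*2) Normc.normc (x k).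
  by rewrite /tail lerBrDl (le_trans h) ?sum_le_rnorm.
elim: K => [|K IH]; first by rewrite big_ord0 addr0 addn0.
rewrite doubleS !addnS !big_ord_recr /= [leLHS]addrA -[leRHS]addrA lerD //.
by rewrite /fold_seq addnS le_normcD.
Qed.

Definition fold N (x : l1 R) : l1 R :=
  @L1 R (fold_seq N x) (l1_of_bounded_sums (sum_fold_seq_le N x)).

Lemma rnorm_fold_le N (x : l1 R) : rnorm (fold N x) <= tail x N.
Proof. by apply: rnorm_l1_le => K; exact: sum_fold_seq_le. Qed.

Lemma fold_linear N : linear (fold N).
Proof.
move=> a x y; apply/val_inj/funext => k.
rewrite -[LHS]/(a * x (N + k.*2)%N + y (N + k.*2)%N
  + (a * x (N + k.*2.+1)%N + y (N + k.*2.+1)%N)).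
rewrite -[RHS]/(a * (x (N + k.*2)%N + x (N + k.*2.+1)%N)
  + (y (N + k.*2)%N + y (N + k.*2.+1)%N)).
by rewrite mulrDr addrACA.
Qed.

Lemma fold_basis N k (b : bool) : fold N (basis (N + k.*2 + b)) = basis k.
Proof.
apply/val_inj/funext => n.
rewrite -[LHS]/((N + n.*2 == N + k.*2 + b)%N%:R
  + (N + n.*2.+1 == N + k.*2 + b)%N%:R : R[i]) -[RHS]/((n == k)%:R : R[i]).
rewrite -natrD; congr (_%:R); case: b; lia.
Qed.

(** The columns of [T] before [N], those of [fold N] from [N] on. *)
Definition glue_fun (T : blop (l1 R) (l1 R)) N (x : l1 R) : l1 R :=
  \sum_(j < N) x j *: T (basis j) + fold N x.

(** The two parts act on complementary coordinates, so the bounds on their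
    norms add up to [rnorm x]. *)
Lemma rnorm_glue_fun_le T N (x : l1 R) : rnorm T <= 1 ->
  rnorm (glue_fun T N x) <= rnorm x.
Proof.
move=> T1; apply: le_trans (rnormD _ _) _.
have -> : rnorm x = \sum_(j < N) Normc.normc (x j) + tail x N.
  by rewrite addrC subrK.
apply: lerD (rnorm_fold_le _ _); rewrite -[leRHS]mul1r.
apply: (rnorm_comb_le x N (v := fun j => T (basis j))) => j; apply: le_trans (rnorm_op _ _) _.
by rewrite mulr_ile1 ?rnorm_ge0 ?rnorm_basis_le1.
Qed.

Lemma glue_subproof T N : glue_fun T N \in bounded_linear_pred.
Proof.
apply/bounded_linearP; split.
  move=> a x y; rewrite /glue_fun fold_linear scalerDr addrACA; congr (_ + _).
  rewrite scaler_sumr -big_split; apply: eq_bigr => j _ /=.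
  by rewrite scalerA -scalerDl.
exists (rnorm T + 1) => [|x]; first by rewrite addr_ge0 ?rnorm_ge0.
rewrite !rnormE -rmorphM lecR /= (le_trans (rnormD _ _)) // mulrDl mul1r.
apply: lerD; last first.
  apply: le_trans (rnorm_fold_le N x) _; rewrite lerBlDr lerDl.
  by apply: sumr_ge0 => k _; exact: normc_ge0.
apply: le_trans (ler_wpM2l (rnorm_ge0 T) (sum_le_rnorm x N)).
apply: (rnorm_comb_le x N (v := fun j => T (basis j))) => j; apply: le_trans (rnorm_op _ _) _.
by rewrite ler_piMr ?rnorm_ge0 ?rnorm_basis_le1.
Qed.

Definition glue T N : blop (l1 R) (l1 R) := Blop (glue_subproof T N).

Lemma rnorm_glue_le1 T N : rnorm T <= 1 -> rnorm (glue T N) <= 1.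
Proof.
by move=> T1; apply: rnorm_op_le => // x; rewrite mul1r rnorm_glue_fun_le.
Qed.

Lemma glue_positive T N : positive_operator T -> positive_operator (glue T N).
Proof.
move=> T0 x x0 k.
have -> : glue T N x k =
    coord k (\sum_(j < N) x j *: T (basis j)) + fold_seq N x k by [].
rewrite addr_ge0 ?addr_ge0 //.
rewrite (blop_comb (coord k) N x (fun j => T (basis j))).
apply: sumr_ge0 => j _; apply: mulr_ge0 => //.
by apply: T0 => n; rewrite basisE ler0n.
Qed.

(** Both operators agree on [trunc N x], and both are contractions on the rest. *)
Lemma rnorm_glue_sub_le T N (x : l1 R) : rnorm T <= 1 ->
  rnorm (glue T N x - T x) <= 2 * tail x N.
Proof.
move=> T1.
have -> : glue T N x - T x = fold N x - T (x - trunc N x).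
  rewrite blopB (blop_comb T N x basis) opprB addrA.
  by congr (_ - _); exact: addrC.
apply: le_trans (rnormD _ _) _; rewrite mulr_natl mulr2n.
apply: lerD; first exact: rnorm_fold_le.
rewrite -[X in rnorm X]sub0r rnormB subr0.
apply: le_trans (rnorm_op _ _) _; apply: le_trans (rnorm_subr_trunc N x).
by rewrite ler_piMl ?rnorm_ge0.
Qed.

Lemma glue_basis T N k (b : bool) : glue T N (basis (N + k.*2 + b)) = basis k.
Proof.
rewrite -[LHS]/(glue_fun T N _) /glue_fun fold_basis big1 ?add0r // => j _.
rewrite basisE ltn_eqF ?scale0r //; have := ltn_ord j; lia.
Qed.

Lemma glue_columns T N : columns_approximate_twice (glue T N).
Proof.
move=> k n; exists (N + k.*2 + false)%N, (N + k.*2 + true)%N.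
rewrite !glue_basis subrr rnorm0 invr_gt0 ltr0n; split=> //; lia.
Qed.

Lemma glue_cvg (T : blop (l1 R) (l1 R)) : rnorm T <= 1 ->
  (glue T N : sot (l1 R)) @[N --> \oo] --> (T : sot (l1 R)).
Proof.
move=> T1; apply/sot_cvgP => x; apply/(@cvgr0Pnorm_lt _ R[i]^o) => e e0.
have [d d0 ->] : exists2 d : R, 0 < d & e = d%:C.
  exists (complex.Re e); last by rewrite RRe_real// gtr0_real.
  by rewrite -ltcR RRe_real// gtr0_real.
have [M MP] := tail_small x (divr_gt0 d0 (ltr0Sn R 1)).
exists M => // N /MP xN; rewrite /= normr_id.
rewrite -[`|_|]/(`|glue T N x - T x|) rnormE ltcR.
apply: le_lt_trans (rnorm_glue_sub_le N x T1) _.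
by rewrite -ltr_pdivlMl // mulrC.
Qed.

End Density.

(** * Typicality *)

Section Typicality.
Context {R : realType}.

Definition near_columns k n (i j : nat) : set (sot (l1 R)) :=
  [set T | rnorm (sot_eval (basis i) T - basis k) < n.+1%:R^-1 /\
           rnorm (sot_eval (basis j) T - basis k) < n.+1%:R^-1].

Lemma open_near_vector (x y : l1 R) (e : R) :
  open [set T : sot (l1 R) | rnorm (sot_eval x T - y) < e].
Proof.
have -> : [set T : sot (l1 R) | rnorm (sot_eval x T - y) < e] =
    sot_eval x @^-1` ball y e%:C.
  apply/seteqP; split=> T /=; rewrite -ball_normE /= rnormE ltcR rnormB //.
apply: open_comp; last exact: ball_open.
by move=> T _; exact: sot_eval_continuous.
Qed.

Definition twice_set (k n : nat) : set (sot (l1 R)) :=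
  \bigcup_(p in [set p : nat * nat | p.1 != p.2])
    near_columns k n p.1 p.2.

Lemma open_twice_set k n : open (twice_set k n).
Proof.
apply: bigcup_open => p _; apply: openI; exact: open_near_vector.
Qed.

Lemma twice_setP (T : blop (l1 R) (l1 R)) :
  columns_approximate_twice T <-> forall k n, twice_set k n T.
Proof.
split=> h k n.
  have [i [j [ij Ti Tj]]] := h k n.
  by exists (i, j); [exact: ij | split; [exact: Ti | exact: Tj]].
have [[i j] ij [Ti Tj]] := h k n.
by exists i, j; split; [exact: ij | exact: Ti | exact: Tj].
Qed.

(** The pairs [(k, n)] are enumerated by [unpickle], with [(0, 0)] as default for
    the integers that encode no pair, to fit the sequence of open sets in the
    definition of a G_delta set. *)
Lemma typical_columns :
  typical_positive_contraction (fun T : blop (l1 R) (l1 R) =>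
    rnorm T <= 1 /\ columns_approximate_twice T).
Proof.
pose U (m : nat) : set (sot (l1 R)) :=
  let kn := odflt (0%N, 0%N) (unpickle m) in twice_set kn.1 kn.2.
pose F (m : nat) : set (positive_contractions (R := R)) := set_val @^-1` U m.
exists (\bigcap_m F m); split.
- exists F => // m; apply: open_comp; last exact: open_twice_set.
  by move=> T _; exact: initial_continuous.
- move=> O [T OT] [V oV VO].
  have [Tpos T1] : positive_contractions (set_val T) by exact: set_valP.
  rewrite rnormE lecR in T1.
  have VT : V (set_val T) by rewrite -VO in OT.
  have [N _ /(_ N (leqnn N)) VN] := glue_cvg T1 (open_nbhs_nbhs (conj oV VT)).
  have glueP : positive_contractions (glue (set_val T) N).
    by split; [exact: glue_positive | rewrite rnormE lecR rnorm_glue_le1].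
  exists (SigSub (mem_set glueP)); split; first by rewrite -VO.
  move=> m _; apply: (twice_setP _).1; exact: glue_columns.
- move=> T GT; split.
    by have [_] := set_valP T; rewrite rnormE lecR.
  apply/twice_setP => k n.
  by have := GT (pickle (k, n)) I; rewrite /F /U /= pickleK.
Qed.

End Typicality.

Theorem proposition1p4 (R : realType) :
  typical_positive_contraction (fun T : blop (l1 R) (l1 R) =>
    [/\ is_isometry (adjoint T),
        ~ set_surj setT setT (adjoint T) &
        forall lambda : R[i], `|lambda| < 1 ->
          set_surj setT setT (T - lambda *: blop_id : blop (l1 R) (l1 R))]).
Proof.
have [G [GG Gdense GP]] := @typical_columns R.
exists G; split=> // T /GP[T1 Tcols].
have Tlift := columns_lift_approximately Tcols.
have Tiso := adjoint_isometry T1 Tlift.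
by split=> // [|lambda]; [exact: adjoint_not_surj | exact: surj_subr_scalar].
Qed.
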